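(* Let $p$ be a prime and $q=p^2$, let $r_1,r_2$ be integers with $0\le r_1,r_2<p$ and $r_1+r_2<p$, let $k\in\{0,1,\dots,q-2\}$, and put $\vec r=(r_1,r_2)$. Then the representation $V_{\vec r}(k)$ of $\mathrm{GL}_2(\mathbb F_q)$ is $\mathrm{GL}_2(\mathbb F_p)$-distinguished if and only if $r_1=r_2$ and $r_2\equiv -k \pmod{p-1}$.
   Context: All representations are over a fixed algebraic closure $\overline{\mathbb F}_p$ of $\mathbb F_p$. For $r\ge 0$, $\mathrm{Sym}^r(\overline{\mathbb F}_p^2)$ is the space of homogeneous polynomials of degree $r$ in two variables $x,y$ over $\overline{\mathbb F}_p$, with $\begin{pmatrix}a&b\\c&d\end{pmatrix}\cdot P(x,y)=P(ax+cy,bx+dy)$. For $q=p^2$ and $\vec r=(r_1,r_2)$, $V_{\vec r}(k)$ is the representation $\mathrm{Sym}^{r_1}(\overline{\mathbb F}_p^2)\otimes\mathrm{Sym}^{r_2}(\overline{\mathbb F}_p^2)\otimes\det^k$ of $\mathrm{GL}_2(\mathbb F_q)$, in which $\begin{pmatrix}a&b\\c&d\end{pmatrix}$ acts on the first factor by $P(x,y)\mapsto P(ax+cy,bx+dy)$, on the second factor through $\begin{pmatrix}a^{p}&b^{p}\\c^{p}&d^{p}\end{pmatrix}$, i.e. by $P(x,y)\mapsto P(a^px+c^py,b^px+d^py)$, and the whole is twisted by the $k$-th power of the determinant. For $H\le G$, a representation $\pi$ of $G$ is $H$-distinguished if $\mathrm{Hom}_H(\pi,\mathbf 1)\ne 0$,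 where $\mathbf 1$ is the trivial character of $H$. *)

(* Defs.v *)
From HB Require Import structures.
From mathcomp Require Import all_boot all_order all_algebra all_fingroup all_field.
From mathcomp Require Import mpoly.

Set Implicit Arguments.
Unset Strict Implicit.
Unset Printing Implicit Defensive.

Import GRing.Theory.
Local Open Scope ring_scope.

(* Left representations of a finite group on a finite-dimensional space.      *)
(* The representations of mxrepresentation.v are right modules of row         *)
(* vectors, whereas the action studied here is a left action, g (h v) =       *)
(* (g h) v; hence endomorphism-valued representations are used instead.       *)
Record repr (K : fieldType) (gT : finGroupType) (V : vectType K) := Repr {
  repr_act :> gT -> 'End(V);
  repr_act1 : repr_act 1%g = \1%VF;
  repr_actM : forall g h, repr_act (g * h)%g = (repr_act g \o repr_act h)%VF
}.

Section Distinguished.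
Variables (K : fieldType) (gT : finGroupType).

Definition intertwiner (V W : vectType K) (H : {group gT})
    (pi : repr gT V) (sigma : repr gT W) (f : 'Hom(V, W)) : Prop :=
  {in H, forall h, (f \o pi h)%VF = (sigma h \o f)%VF}.

Fact triv_actM (g h : gT) : \1%VF = (\1 \o \1)%VF :> 'End(K^o).
Proof. by rewrite comp_lfun1l. Qed.

Definition triv_repr : repr gT K^o :=
  @Repr K gT K^o (fun=> \1%VF) erefl triv_actM.

Definition distinguished (V : vectType K) (H : {group gT}) (pi : repr gT V) :
    Prop :=
  exists f : 'Hom(V, K^o), f != 0 /\ intertwiner H pi triv_repr f.

End Distinguished.

Section Twist.
Variables (K : fieldType) (gT : finGroupType) (V : vectType K).
Variables (chi : gT -> K) (chi1 : chi 1%g = 1).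
Variables (chiM : {morph chi : g h / (g * h)%g >-> g * h}) (pi : repr gT V).

Fact twist_act1 : chi 1%g *: pi 1%g = \1%VF.
Proof. by rewrite chi1 scale1r repr_act1. Qed.

Fact twist_actM g h :
  chi (g * h)%g *: pi (g * h)%g = (chi g *: pi g \o chi h *: pi h)%VF.
Proof.
by rewrite chiM repr_actM -comp_lfunZl -comp_lfunZr scalerA.
Qed.

Definition twist_repr : repr gT V := Repr twist_act1 twist_actM.

End Twist.

(* The tensor product of V and W, modelled on coordinates with respect to     *)
(* chosen bases of V and W; tensor_liftE and tensor_ext below are its         *)
(* universal property.                                                        *)
Section Tensor.
Variable K : fieldType.

Definition tensor (V W : vectType K) : vectType K :=
  'M[K]_(\dim {:V}, \dim {:W}).

Definition tens (V W : vectType K) (v : V) (w : W) : tensor V W :=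
  \matrix_(i, j) (coord (vbasis {:V}) i v * coord (vbasis {:W}) j w).

Definition tensor_lift_fun (V W U : vectType K) (b : V -> W -> U)
    (t : tensor V W) : U :=
  \sum_i \sum_j t i j *: b (vbasis {:V})`_i (vbasis {:W})`_j.

Fact tensor_lift_fun_linear (V W U : vectType K) (b : V -> W -> U) :
  linear (tensor_lift_fun b).
Proof.
move=> a s t; rewrite /tensor_lift_fun scaler_sumr -big_split.
apply: eq_bigr => i _ /=; rewrite scaler_sumr -big_split.
by apply: eq_bigr => j _ /=; rewrite !mxE scalerDl scalerA.
Qed.

HB.instance Definition _ (V W U : vectType K) (b : V -> W -> U) :=
  GRing.isLinear.Build K (tensor V W) U *:%R (tensor_lift_fun b)
    (tensor_lift_fun_linear b).

Definition tensor_lift (V W U : vectType K) (b : V -> W -> U) :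
    'Hom(tensor V W, U) :=
  linfun (tensor_lift_fun b).

Section Theory.
Variables (V W : vectType K).

Lemma tens_linearl w : linear (fun v : V => tens v w : tensor V W).
Proof.
by move=> a v v'; apply/matrixP => i j; rewrite !mxE linearP mulrDl mulrA.
Qed.

Lemma tens_linearr v : linear (fun w : W => tens v w : tensor V W).
Proof.
move=> a w w'; apply/matrixP => i j.
by rewrite !mxE linearP mulrDr mulrCA.
Qed.

Lemma tens_delta (i : 'I_(\dim {:V})) (j : 'I_(\dim {:W})) :
  tens (vbasis {:V})`_i (vbasis {:W})`_j = delta_mx i j :> tensor V W.
Proof.
have fV := basis_free (vbasisP {:V}); have fW := basis_free (vbasisP {:W}).
apply/matrixP => k l; rewrite !mxE !coord_free // -natrM mulnb.
by rewrite [i == k]eq_sym [j == l]eq_sym.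
Qed.

Lemma tensor_ext (U : vectType K) (f g : 'Hom(tensor V W, U)) :
  (forall v w, f (tens v w) = g (tens v w)) -> f = g.
Proof.
move=> efg; apply/lfunP => t; rewrite [t]matrix_sum_delta !linear_sum /=.
apply: eq_bigr => i _; rewrite !linear_sum /=; apply: eq_bigr => j _.
by rewrite !linearZ /= -tens_delta efg.
Qed.

Lemma tensor_liftE (U : vectType K) (b : V -> W -> U) v w :
    (forall w, linear (b^~ w)) -> (forall v, linear (b v)) ->
  tensor_lift b (tens v w) = b v w.
Proof.
move=> bl br; rewrite lfunE /= /tensor_lift_fun.
pose BL w := GRing.isLinear.Build K V U *:%R (b^~ w) (bl w).
pose Bl w : {linear V -> U} := HB.pack (b^~ w) (BL w).
pose BR v := GRing.isLinear.Build K W U *:%R (b v) (br v).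
pose Br v : {linear W -> U} := HB.pack (b v) (BR v).
rewrite -[RHS]/(Bl w v) [in RHS](coord_vbasis (memvf v)) linear_sum.
apply: eq_bigr => i _; rewrite linearZ /=.
rewrite -[b _ w]/(Br _ w) [in RHS](coord_vbasis (memvf w)) linear_sum.
rewrite scaler_sumr; apply: eq_bigr => j _.
by rewrite linearZ /= scalerA mxE.
Qed.

End Theory.

Definition tensor_map (V V' W W' : vectType K) (f : 'Hom(V, V'))
    (g : 'Hom(W, W')) : 'Hom(tensor V W, tensor V' W') :=
  tensor_lift (fun v w => tens (f v) (g w)).

Lemma tensor_mapE (V V' W W' : vectType K) (f : 'Hom(V, V'))
    (g : 'Hom(W, W')) v w :
  tensor_map f g (tens v w) = tens (f v) (g w).
Proof.
apply: (tensor_liftE (b := fun v w => tens (f v) (g w))) => [{}w|{}v] a u u'.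
  by rewrite linearP tens_linearl.
by rewrite linearP tens_linearr.
Qed.

Section Repr.
Variables (gT : finGroupType) (V W : vectType K).
Variables (pi : repr gT V) (sigma : repr gT W).

Fact tensor_act1 : tensor_map (pi 1%g) (sigma 1%g) = \1%VF.
Proof. by apply: tensor_ext => v w; rewrite tensor_mapE !repr_act1 !id_lfunE. Qed.

Fact tensor_actM g h : tensor_map (pi (g * h)%g) (sigma (g * h)%g) =
  (tensor_map (pi g) (sigma g) \o tensor_map (pi h) (sigma h))%VF.
Proof.
apply: tensor_ext => v w.
by rewrite comp_lfunE !tensor_mapE !repr_actM !comp_lfunE.
Qed.

Definition tensor_repr : repr gT (tensor V W) := Repr tensor_act1 tensor_actM.

End Repr.
End Tensor.

Section SymPow.
Variable K : fieldType.

Definition SymPow (r : nat) : vectType K := dhomog 2 K r.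

(* P(x, y) |-> P(a x + c y, b x + d y) for A = (a, b; c, d), with x = 'X_0    *)
(* and y = 'X_1.                                                              *)
Definition lin_subst (A : 'M[K]_2) (P : {mpoly K[2]}) : {mpoly K[2]} :=
  P \mPo [tuple A 0 0 *: 'X_0 + A 1 0 *: 'X_1; A 0 1 *: 'X_0 + A 1 1 *: 'X_1].

Lemma lin_substX (A : 'M[K]_2) j : lin_subst A 'X_j = \sum_i A i j *: 'X_i.
Proof.
rewrite /lin_subst comp_mpolyXU big_ord_recl big_ord1.
rewrite (_ : lift ord0 ord0 = 1); last exact/val_inj.
case: j => [[|[|//]]] lt_j /=; congr (_ *: _ + _ *: _);
  by congr (A _ _); apply: val_inj.
Qed.

Lemma lin_subst_homog (A : 'M[K]_2) r (P : {mpoly K[2]}) :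
  P \is r.-homog -> lin_subst A P \is r.-homog.
Proof.
move=> /dhomogP homP; rewrite /lin_subst comp_mpolyEX big_seq.
apply: rpred_sum => m mP; apply: rpredZ; rewrite -(homP m mP) /= mdegE.
rewrite comp_mpolyX -!/(lin_subst A _).
elim/big_rec2: _ => [|i d Q _ IH]; first exact: dhomog1.
apply: dhomogM => //; move: (m i) => e; rewrite -[X in X.-homog]mul1n.
apply: dhomogMn.
rewrite (tnth_nth 0) -comp_mpolyXU -/(lin_subst A _) lin_substX.
by apply: rpred_sum => j _; apply: rpredZ; rewrite dhomogX /= mdeg1.
Qed.

Lemma lin_subst1 P : lin_subst 1%:M P = P.
Proof.
rewrite -[RHS]comp_mpoly_id; congr (P \mPo _); apply: eq_from_tnth => i.
rewrite (tnth_nth 0) -comp_mpolyXU -/(lin_subst _ _) lin_substX tnth_mktuple.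
rewrite (bigD1 i) //= mxE eqxx scale1r big1 ?addr0 // => j nji.
by rewrite mxE (negPf nji) scale0r.
Qed.

Lemma lin_substM A B P : lin_subst (A *m B) P = lin_subst A (lin_subst B P).
Proof.
have eX j : lin_subst (A *m B) 'X_j = lin_subst A (lin_subst B 'X_j).
  rewrite !lin_substX /lin_subst linear_sum /=.
  under [RHS]eq_bigr => i _.
    rewrite linearZ /= -/(lin_subst A _) lin_substX scaler_sumr; over.
  rewrite exchange_big; apply: eq_bigr => i _ /=.
  rewrite mxE scaler_suml; apply: eq_bigr => k _.
  by rewrite scalerA mulrC.
elim/mpolyind: P => [|c m P _ _ IH]; first by rewrite /lin_subst !comp_mpoly0.
move: IH; rewrite /lin_subst !comp_mpolyD !comp_mpolyZ => ->.
congr (_ *: _ + _); rewrite (mpolyXE_id _ m) !rmorph_prod /=.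
by apply: eq_bigr => i _; rewrite !rmorphXn /= -!/(lin_subst _ _) eX.
Qed.

Definition sym_act r (A : 'M[K]_2) (P : SymPow r) : SymPow r :=
  DHomog (lin_subst_homog A (dhomog_is_dhomog P)).

Fact sym_act_linear r A : linear (@sym_act r A).
Proof. by move=> a P Q; apply: val_inj; rewrite /= /lin_subst linearP. Qed.

HB.instance Definition _ r A :=
  GRing.isLinear.Build K (SymPow r) (SymPow r) *:%R (@sym_act r A)
    (sym_act_linear A).

Section SymRepr.
Variables (F : finFieldType) (phi : {rmorphism F -> K}) (r : nat).

Definition sym_repr_fun (g : {'GL_2[F]}) : 'End(SymPow r) :=
  linfun (sym_act (map_mx phi (GLval g))).

Fact sym_repr1 : sym_repr_fun 1%g = \1%VF.
Proof.
apply/lfunP => P; rewrite id_lfunE lfunE; apply: val_inj.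
by rewrite /= map_mx1 lin_subst1.
Qed.

Fact sym_reprM g h : sym_repr_fun (g * h)%g =
  (sym_repr_fun g \o sym_repr_fun h)%VF.
Proof.
apply/lfunP => P; rewrite comp_lfunE !lfunE; apply: val_inj.
by rewrite /= map_mxM lin_substM.
Qed.

Definition sym_repr : repr {'GL_2[F]} (SymPow r) := Repr sym_repr1 sym_reprM.

Definition det_char (k : nat) (g : {'GL_2[F]}) : K := phi (\det (GLval g)) ^+ k.

Fact det_char1 k : det_char k 1%g = 1.
Proof. by rewrite /det_char det1 rmorph1 expr1n. Qed.

Fact det_charM k : {morph det_char k : g h / (g * h)%g >-> g * h}.
Proof. by move=> g h; rewrite /det_char det_mulmx rmorphM exprMn. Qed.

End SymRepr.
End SymPow.

Fact pchar_rmorph p (K : fieldType) (i : {rmorphism 'F_p -> K}) :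
  prime p -> p \in [pchar K].
Proof. by move=> p_pr; apply: (rmorph_pchar i); apply: pchar_Fp. Qed.

Definition V_repr p (K : fieldType) (pcharK : p \in [pchar K])
    (F : finFieldType) (phi : {rmorphism F -> K}) (r1 r2 k : nat) :
    repr {'GL_2[F]} (tensor (SymPow K r1) (SymPow K r2)) :=
  twist_repr (det_char1 phi k) (det_charM phi k)
    (tensor_repr (sym_repr phi r1)
       (sym_repr (pFrobenius_aut pcharK \o phi) r2)).

Section GLMap.
Variables (F E : finFieldType) (i : {rmorphism F -> E}).

Fact GL_map_unit (g : {'GL_2[F]}) : map_mx i (GLval g) \is a GRing.unit.
Proof. exact: rmorph_unit (GL_unit g). Qed.

Definition GL_map (g : {'GL_2[F]}) : {'GL_2[E]} :=
  FinRing.unit _ (GL_map_unit g).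

Fact GL_mapM : {in 'GL_2[F]%g &, {morph GL_map : g h / (g * h)%g}}.
Proof. by move=> g h _ _; apply: val_inj; rewrite /= map_mxM. Qed.

Canonical GL_map_morphism := Morphism GL_mapM.

Definition GL_sub : {group {'GL_2[E]}} := (GL_map @* 'GL_2[F])%G.

End GLMap.

(* Main.v *)
(* As Frobenius fixes F_p, an invariant functional is a bilinear form on       *)
(* Sym^r1 x Sym^r2 multiplied by det^-k under GL_2(F_p); let c(s, t) be its    *)
(* value at (x^s y^(r1-s), x^t y^(r2-t)). Invariance under (1, b; 0, 1) is a   *)
(* polynomial identity in b of degree <= r1 + r2 < p, so its linear            *)
(* coefficient gives (r1-s) c(s+1, t) + (r2-t) c(s, t+1) = 0, which forces     *)
(* s + t <= min(r1, r2) wherever c(s, t) != 0. Exchanging x and y yields       *)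
(* s + t >= max(r1, r2). Hence r1 = r2 = s + t, and diag(a, 1) acts on such a  *)
(* term by a^(k+s+t), so p - 1 divides k + r2. Conversely, for r1 = r2 = r the *)
(* form determined by B(P, (u x + v y)^r) = P(-v, u) is multiplied by det^r.   *)
From HB Require Import structures.
Require Import Defs.
From mathcomp Require Import all_boot all_order all_algebra all_fingroup all_field.
From mathcomp Require Import mpoly.
From mathcomp Require Import zify ring.

Set Implicit Arguments.
Unset Strict Implicit.
Unset Printing Implicit Defensive.

Import GRing.Theory.
Local Open Scope ring_scope.

(** Frobenius is trivial on F_p, so [distinguished_det_invariant] turns the question into one about
    bilinear forms. The bound r1 + r2 < p lets invariance under the finite unipotent group be
    differentiated: by [poly_Fp_vanish] it is a polynomial identity in b, whose linear term is the
    relation for the raising operator of sl_2 ([raising_relation]). Solving it ([raising_vanish]),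
    together with the swap and the torus, gives necessity in [det_invariant_weights]. For
    sufficiency, [sym_pairing] is the form on Sym^r induced by the determinant form on the plane;
    its equivariance is tested on powers of linear forms, which span because r < p. *)

Section PrimeField.

(** * Polynomials and exponents over F_p *)

Variables (p : nat) (p_pr : prime p) (K : fieldType).
Variable theta : {rmorphism 'F_p -> K}.

Lemma poly_Fp_vanish (P : {poly K}) :
  (size P <= p)%N -> (forall u, P.[theta u] = 0) -> P = 0.
Proof.
move=> sizeP P0; apply: (@roots_geq_poly_eq0 _ P (map theta (enum 'F_p))).
- by apply/allP => _ /mapP[u _ ->]; apply/rootP.
- by rewrite map_inj_uniq ?enum_uniq //; apply: fmorph_inj.
- by rewrite size_map -cardE card_Fp.
Qed.

Lemma natr_neq0_lt n : (0 < n < p)%N -> n%:R != 0 :> K.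
Proof.
case/andP=> n0 np; rewrite -(dvdn_pcharf (pchar_rmorph theta p_pr)).
by rewrite gtnNdvd.
Qed.

Lemma bin_neq0_lt n m : (m <= n < p)%N -> 'C(n, m)%:R != 0 :> K.
Proof.
case/andP=> mn np; rewrite -(dvdn_pcharf (pchar_rmorph theta p_pr)).
apply/negP => /(dvdn_mulr (m`! * (n - m)`!)); rewrite bin_fact //.
elim: n np {mn} => [|n IHn] np; first by rewrite dvdn1 gtn_eqF ?prime_gt1.
by rewrite factS Euclid_dvdM // gtnNdvd //=; apply: IHn; apply: ltnW.
Qed.

Lemma Fp_exp1 (u : 'F_p) : u != 0 -> u ^+ p.-1 = 1.
Proof.
move=> u0; apply: (mulIf u0); rewrite mul1r -exprSr prednK ?prime_gt0 //.
by have := expf_card u; rewrite card_Fp.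
Qed.

(** No generator of the unit group is needed: if e is n modulo p - 1, then X^(e+1) - X has degree
    below p and vanishes on all of F_p, hence is zero, which forces e = 0. *)
Lemma exp_Fp_dvd n :
  (forall u : 'F_p, u != 0 -> theta u ^+ n = 1) -> (p.-1 %| n)%N.
Proof.
move=> un1.
have p1_gt0 : (0 < p.-1)%N by rewrite -subn1 subn_gt0 prime_gt1.
rewrite /dvdn; set e := (n %% p.-1)%N.
have e_lt : (e < p.-1)%N by rewrite ltn_mod.
have P0 : 'X^(e.+1) - 'X = 0 :> {poly K}.
  apply: poly_Fp_vanish => [|u].
    rewrite (leq_trans (size_polyD _ _)) // size_polyN size_polyXn size_polyX.
    by rewrite geq_max prime_gt1 // andbT -ltn_predRL.
  rewrite !hornerE; have [-> | u0] := eqVneq u 0.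
    by rewrite rmorph0 expr0n subrr.
  rewrite exprSr -[X in X * _]mulr1 -[X in _ * X * _](expr1n _ (n %/ p.-1)).
  rewrite -(rmorph1 theta) -(Fp_exp1 u0) rmorphXn -exprM mulnC -exprD addnC.
  by rewrite -divn_eq un1 // mul1r subrr.
move/(congr1 (fun P : {poly K} => P`_1)): P0.
rewrite coefB coefXn coefX coef0 eqxx eqSS eq_sym.
by case: (e == 0)%N => //= /eqP; rewrite sub0r oppr_eq0 oner_eq0.
Qed.

End PrimeField.

(** * The monomial basis of Sym^r *)

Section Monomials.
Variable K : fieldType.

Definition bideg r s : 'X_{1..2} :=
  [multinom if i == 0%R then s else (r - s)%N | i < 2].

Lemma ord2P (i : 'I_2) : i = 0 \/ i = 1.
Proof. by case: i => [[|[|//]]] lt; [left | right]; apply: val_inj. Qed.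

Lemma mpolyX_bideg r s :
  'X_[bideg r s] = 'X_0 ^+ s * 'X_1 ^+ (r - s) :> {mpoly K[2]}.
Proof.
rewrite mpolyXE_id big_ord_recl big_ord1 !mnmE /=.
by rewrite (_ : lift _ _ = 1) //; apply: val_inj.
Qed.

(** Polynomials that are not homogeneous of degree r go to 0; in particular [hmon r s] is 0 for s >
    r. *)
Definition hproj r (P : {mpoly K[2]}) : SymPow K r := insubd (0 : SymPow K r) P.

Lemma hprojK r P : P \is r.-homog -> mpoly_of_dhomog (hproj r P) = P.
Proof. by move=> homP; rewrite /hproj -[LHS]/(val _) val_insubd homP. Qed.

Definition hmon r s : SymPow K r := hproj r 'X_[bideg r s].

Lemma mdeg_bideg r s : (s <= r)%N -> mdeg (bideg r s) = r.
Proof.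
by move=> sr; rewrite mdegE big_ord_recl big_ord1 !mnmE /= subnKC.
Qed.

Lemma hmonE r s : (s <= r)%N ->
  mpoly_of_dhomog (hmon r s) = 'X_0 ^+ s * 'X_1 ^+ (r - s).
Proof.
by move=> sr; rewrite -mpolyX_bideg hprojK // dhomogX /= mdeg_bideg.
Qed.

Definition hcoef r s (P : SymPow K r) : K := (mpoly_of_dhomog P)@_(bideg r s).

Lemma hcoef_linear r s : linear (@hcoef r s : SymPow K r -> K^o).
Proof. by move=> a P Q; rewrite /hcoef /= mcoeffD mcoeffZ. Qed.

Lemma bideg_inj r s t : bideg r s = bideg r t -> s = t.
Proof. by move/mnmP/(_ 0); rewrite !mnmE. Qed.

Lemma hcoef_hmon r s t : (t <= r)%N -> hcoef s (hmon r t) = (s == t)%:R.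
Proof.
move=> tr; rewrite /hcoef hmonE // -mpolyX_bideg mcoeffX eq_sym; congr (_%:R).
by congr nat_of_bool; apply/eqP/eqP => [/bideg_inj|->].
Qed.

Lemma hmon_span r (P : SymPow K r) : P = \sum_(s < r.+1) hcoef s P *: hmon r s.
Proof.
apply: val_inj => /=; rewrite raddf_sum /=; apply/mpolyP => m.
rewrite raddf_sum /=; have homP := dhomog_is_dhomog P.
under eq_bigr => s _ do
  rewrite mcoeffZ hmonE -1?ltnS // -mpolyX_bideg mcoeffX.
have [dm | dm] := eqVneq (mdeg m) r; last first.
  rewrite (dhomog_nemf_coeff homP) // big1 // => s _.
  case: eqP => [em | _]; last by rewrite mulr0.
  by rewrite -em mdeg_bideg ?eqxx -1?ltnS in dm.
have em : m = bideg r (m 0).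
  apply/mnmP => i; rewrite mnmE -dm mdegE big_ord_recl big_ord1.
  rewrite (_ : lift ord0 ord0 = 1); last exact: val_inj.
  by have [-> | ->] := ord2P i; rewrite //= addKn.
have m0r : (m 0%R < r.+1)%N.
  by rewrite ltnS -dm mdegE big_ord_recl leq_addr.
rewrite (bigD1 (Ordinal m0r)) //= /hcoef -em eqxx mulr1 big1 ?addr0 //.
move=> s ns; rewrite em; case: eqP => [/bideg_inj es | _]; last by rewrite mulr0.
by rewrite -(inj_eq val_inj) /= es eqxx in ns.
Qed.

End Monomials.

(** * Explicit action on monomials and on powers of linear forms *)

Section Action.
Variable K : fieldType.

Definition mx2 (R : nzRingType) (a b c d : R) : 'M[R]_2 :=
  \matrix_(i, j) if i == 0 then (if j == 0 then a else b)
                 else (if j == 0 then c else d).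

Lemma map_mx2 (R S : nzRingType) (h : {rmorphism R -> S}) a b c d :
  map_mx h (mx2 a b c d) = mx2 (h a) (h b) (h c) (h d).
Proof. by apply/matrixP => i j; rewrite !mxE; do 2!case: ifP. Qed.

Lemma det2 (R : comNzRingType) (A : 'M[R]_2) :
  \det A = A 0 0 * A 1 1 - A 0 1 * A 1 0.
Proof.
rewrite (expand_det_row _ 0) big_ord_recl big_ord1 /cofactor !det_mx11 !mxE.
rewrite (_ : lift ord0 ord0 = 1); last exact: val_inj.
rewrite (_ : lift 1 0 = 0); last exact: val_inj.
by rewrite /= expr0 expr1 mul1r mulN1r mulrN.
Qed.

Lemma lin_substM_poly (A : 'M[K]_2) P Q :
  lin_subst A (P * Q) = lin_subst A P * lin_subst A Q.
Proof. by rewrite /lin_subst rmorphM. Qed.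

Lemma lin_substXn (A : 'M[K]_2) P n : lin_subst A (P ^+ n) = lin_subst A P ^+ n.
Proof. by rewrite /lin_subst rmorphXn. Qed.

Lemma lin_substX2 (A : 'M[K]_2) j :
  lin_subst A 'X_j = A 0 j *: 'X_0 + A 1 j *: 'X_1.
Proof.
rewrite lin_substX big_ord_recl big_ord1.
by rewrite (_ : lift ord0 ord0 = 1) //; apply: val_inj.
Qed.

Lemma sym_act_hmon (A : 'M[K]_2) r s : (s <= r)%N ->
  mpoly_of_dhomog (sym_act A (hmon K r s)) =
  (A 0 0 *: 'X_0 + A 1 0 *: 'X_1) ^+ s *
  (A 0 1 *: 'X_0 + A 1 1 *: 'X_1) ^+ (r - s).
Proof.
by move=> sr; rewrite /= hmonE // lin_substM_poly !lin_substXn !lin_substX2.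
Qed.

Lemma sym_act_diag (a : K) r s : (s <= r)%N ->
  sym_act (mx2 a 0 0 1) (hmon K r s) = a ^+ s *: hmon K r s.
Proof.
move=> sr; apply: val_inj; rewrite [LHS]sym_act_hmon //= hmonE // !mxE /=.
by rewrite !scale0r addr0 add0r scale1r exprZn scalerAl.
Qed.

Lemma sym_act_swap r s : (s <= r)%N ->
  sym_act (mx2 0 1 1 0) (hmon K r s) = hmon K r (r - s).
Proof.
move=> sr; apply: val_inj; rewrite [LHS]sym_act_hmon //= hmonE ?leq_subr //.
by rewrite !mxE /= !scale0r addr0 add0r !scale1r subKn // mulrC.
Qed.

(** The matrix fixes x and sends y to b x + y, so this is the binomial expansion of x^s (b x +
    y)^(r-s). *)
Lemma sym_act_unip (b : K) r s : (s <= r)%N ->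
  sym_act (mx2 1 b 0 1) (hmon K r s) =
  \sum_(i < (r - s).+1) ('C(r - s, i)%:R * b ^+ i) *: hmon K r (s + i).
Proof.
move=> sr; apply: val_inj; rewrite [LHS]sym_act_hmon //= !mxE /=.
rewrite scale0r addr0 !scale1r addrC exprDn mulr_sumr raddf_sum /=.
apply: eq_bigr => i _; have ile : (s + i <= r)%N.
  by rewrite -leq_subRL // -ltnS.
rewrite hmonE // exprZn -scalerAr -scaler_nat scalerA -scalerAr; congr (_ *: _).
by rewrite mulrCA mulrC exprD -subnDA.
Qed.

Definition evalh r (P : SymPow K r) (a b : K) : K :=
  (mpoly_of_dhomog P).@[fun i => if i == 0 then a else b].

Lemma evalhE r (P : SymPow K r) a b :
  evalh P a b = \sum_(s < r.+1) hcoef s P * (a ^+ s * b ^+ (r - s)).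
Proof.
rewrite /evalh {1}(hmon_span P) raddf_sum raddf_sum /=.
apply: eq_bigr => s _; rewrite mevalZ hmonE -1?ltnS //.
by rewrite rmorphM !rmorphXn /= !mevalXU.
Qed.

Lemma evalhZ r (P : SymPow K r) c a b :
  evalh P (c * a) (c * b) = c ^+ r * evalh P a b.
Proof.
rewrite !evalhE mulr_sumr; apply: eq_bigr => s _.
rewrite !exprMn mulrACA -exprD subnKC -1?ltnS //.
exact: mulrCA.
Qed.

Lemma evalh_act (A : 'M[K]_2) r (P : SymPow K r) a b :
  evalh (sym_act A P) a b =
  evalh P (A 0 0 * a + A 1 0 * b) (A 0 1 * a + A 1 1 * b).
Proof.
rewrite /evalh /= /lin_subst comp_mpoly_meval; apply: meval_eq => i.
by have [-> | ->] := ord2P i; rewrite (tnth_nth 0) /= mevalD !mevalZ !mevalXU.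
Qed.

(** The power (u x + v y)^r, expanded so that it lies in Sym^r by construction. *)
Definition linpow r (u v : K) : SymPow K r :=
  \sum_(t < r.+1) ('C(r, t)%:R * (u ^+ t * v ^+ (r - t))) *: hmon K r t.

Lemma linpowE r u v :
  mpoly_of_dhomog (linpow r u v) = (u *: 'X_0 + v *: 'X_1) ^+ r.
Proof.
rewrite raddf_sum /= addrC exprDn; apply: eq_bigr => t _.
rewrite hmonE -1?ltnS // !exprZn -scalerAl -scalerAr scalerA -scaler_nat scalerA.
by congr (_ *: _); rewrite 1?mulrC // [v ^+ _ * _]mulrC mulrC.
Qed.

Lemma sym_act_linpow (A : 'M[K]_2) r u v :
  sym_act A (linpow r u v) =
  linpow r (A 0 0 * u + A 0 1 * v) (A 1 0 * u + A 1 1 * v).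
Proof.
apply: val_inj; rewrite /= !linpowE lin_substXn; congr (_ ^+ _).
rewrite {1}/lin_subst raddfD /= !comp_mpolyZ -!/(lin_subst _ _) !lin_substX2.
rewrite !scalerDr !scalerA !scalerDl addrACA.
by congr (_ + _ + (_ + _)); rewrite mulrC.
Qed.

Lemma hcoef_linpow r u v t : (t <= r)%N ->
  hcoef t (linpow r u v) = 'C(r, t)%:R * (u ^+ t * v ^+ (r - t)).
Proof.
rewrite -ltnS => tr; rewrite /hcoef !raddf_sum /= (bigD1 (Ordinal tr)) //=.
rewrite mcoeffZ -/(hcoef _ _) hcoef_hmon // eqxx mulr1 big1 ?addr0 // => s ns.
rewrite mcoeffZ -/(hcoef _ _) hcoef_hmon -1?ltnS // eq_sym.
by rewrite (_ : (_ == _) = false) ?mulr0 //; apply: negbTE.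
Qed.

Section Span.
Variables (p : nat) (p_pr : prime p) (theta : {rmorphism 'F_p -> K}).

(** D((u x + y)^r) is a polynomial in u of degree at most r < p that vanishes on F_p. Its
    coefficients C(r, t) D(x^t y^(r-t)) are thus zero, and the binomials are invertible. *)
Lemma linpow_span r (D : SymPow K r -> K^o) : (r < p)%N -> linear D ->
  (forall u, D (linpow r (theta u) 1) = 0) -> forall Q, D Q = 0.
Proof.
move=> rp linD D0.
pose DL := GRing.isLinear.Build K _ _ *:%R D linD.
pose D' : {linear SymPow K r -> K^o} := HB.pack D DL.
suff Dmon t : (t < r.+1)%N -> D (hmon K r t) = 0.
  move=> Q; rewrite (hmon_span Q) -[D _]/(D' _) linear_sum big1 // => t _.
  by rewrite linearZ /= Dmon // scaler0.
move=> tr; pose P := \poly_(t < r.+1) ('C(r, t)%:R * D (hmon K r t)).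
have P0 : P = 0.
  apply: (poly_Fp_vanish p_pr (theta := theta)) => [|u].
    exact: leq_trans (size_poly _ _) rp.
  rewrite horner_poly -[RHS](D0 u) -[RHS]/(D' _) linear_sum.
  apply: eq_bigr => s _; rewrite linearZ /= expr1n mulr1 /GRing.scale /=.
  by rewrite mulrAC.
move/(congr1 (fun P : {poly K} => P`_t)): P0; rewrite coef0 coef_poly tr.
move/eqP; rewrite mulf_eq0 => /orP[|/eqP //].
by rewrite (negPf (bin_neq0_lt p_pr theta _)) // -ltnS tr.
Qed.

End Span.
End Action.

Lemma tens_sum (K : fieldType) (V W : vectType K) (f : 'Hom(tensor V W, K^o))
    m n (a : 'I_m -> K) (b : 'I_n -> K) (v : 'I_m -> V) (w : 'I_n -> W) :
  f (tens (\sum_s a s *: v s) (\sum_t b t *: w t)) =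
  \sum_s \sum_t a s * b t * f (tens (v s) (w t)).
Proof.
have -> : tens (\sum_s a s *: v s) (\sum_t b t *: w t) =
    \sum_s \sum_t (a s * b t) *: (tens (v s) (w t) : tensor V W).
  apply/matrixP => x y; rewrite !mxE summxE !linear_sum mulr_suml.
  apply: eq_bigr => s _; rewrite summxE mulr_sumr; apply: eq_bigr => t _.
  by rewrite !linearZ !mxE /= /GRing.scale /= mulrACA.
rewrite linear_sum; apply: eq_bigr => s _; rewrite linear_sum.
by apply: eq_bigr => t _; rewrite linearZ.
Qed.

(** Extracts the linear coefficient of a double sum of monomials X^(m+n). The two hypotheses cover
    the cases where (1, 0) or (0, 1) falls outside the range of summation. *)
Lemma sum_pair_index1 (R : nzSemiRingType) (F : nat -> nat -> R) a b :
  (a = 0%N -> F 1%N 0%N = 0) -> (b = 0%N -> F 0%N 1%N = 0) ->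
  \sum_(m < a.+1) \sum_(n < b.+1) F m n * (1 == m + n)%N%:R =
  F 1%N 0%N + F 0%N 1%N.
Proof.
move=> a0 b0; rewrite big_ord_recl addrC; congr (_ + _).
  case: a a0 => [-> //|a _]; first by rewrite big_ord0.
  rewrite big_ord_recl [X in _ + X]big1 ?addr0 => [|m _]; last first.
    by rewrite big1 // => n _; rewrite mulr0.
  rewrite big_ord_recl mulr1 big1 ?addr0 // => n _.
  by rewrite mulr0.
rewrite big_ord_recl mulr0 add0r.
case: b b0 => [-> //|b _]; first by rewrite big_ord0.
by rewrite big_ord_recl mulr1 big1 ?addr0 // => n _; rewrite mulr0.
Qed.

(** * Invariant forms: constraints on the weights, then existence *)

Section InvariantForms.
Variables (p : nat) (p_pr : prime p) (K : fieldType).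
Variable theta : {rmorphism 'F_p -> K}.

Definition det_invariant r1 r2 k
    (f : 'Hom(tensor (SymPow K r1) (SymPow K r2), K^o)) : Prop :=
  forall A : 'M['F_p]_2, A \in unitmx -> forall P Q,
    theta (\det A) ^+ k *
      f (tens (sym_act (map_mx theta A) P) (sym_act (map_mx theta A) Q)) =
    f (tens P Q).

(** Descending induction on t: c(s, t+1) vanishes by induction, or has coefficient 0 when t = r2.
    The relation then leaves (r1-s) c(s+1, t) = 0 with 0 < r1-s < p. *)
Lemma raising_vanish (c : nat -> nat -> K) r1 r2 : (r1 < p)%N ->
    (forall s t, (s <= r1)%N -> (t <= r2)%N ->
       (r1 - s)%:R * c s.+1 t + (r2 - t)%:R * c s t.+1 = 0) ->
  forall s t, (s <= r1)%N -> (t <= r2)%N -> (r2 < s + t)%N -> c s t = 0.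
Proof.
move=> r1p rel s t sr1 tr2; move def_d: (r2 - t)%N => d.
have cancel n m : (n < r1)%N -> (r1 - n)%:R * c n.+1 m = 0 -> c n.+1 m = 0.
  move=> nr1 /eqP; rewrite mulf_eq0 (negPf (natr_neq0_lt p_pr theta _)).
    by move/eqP.
  by rewrite subn_gt0 nr1 (leq_ltn_trans (leq_subr _ _) r1p).
elim: d s t sr1 tr2 def_d => [|d IHd] [|s] t sr1 tr2 def_d;
  try by rewrite ltnNge tr2.
  move=> _; apply: cancel => //; have := rel s t (ltnW sr1) tr2.
  by rewrite def_d mul0r addr0.
move=> lt_r2; have tr2' : (t < r2)%N by rewrite -subn_gt0 def_d.
apply: cancel => //; have := rel s t (ltnW sr1) tr2.
rewrite (IHd s t.+1) ?mulr0 ?addr0 //; first exact: ltnW.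
  by rewrite subnS def_d.
by rewrite addnS -addSn.
Qed.

Section Forms.
Variables (r1 r2 k : nat) (f : 'Hom(tensor (SymPow K r1) (SymPow K r2), K^o)).
Hypotheses (r12_lt : (r1 + r2 < p)%N) (f_inv : det_invariant k f).

Let c s t : K := f (tens (hmon K r1 s) (hmon K r2 t)).

(* For s = r1 or t = r2 the entry of c that is out of range has coefficient 0. *)
Lemma raising_relation s t : (s <= r1)%N -> (t <= r2)%N ->
  (r1 - s)%:R * c s.+1 t + (r2 - t)%:R * c s t.+1 = 0.
Proof.
move=> sr1 tr2; pose a := (r1 - s)%N; pose b := (r2 - t)%N.
pose e m n : K := 'C(a, m)%:R * 'C(b, n)%:R * c (s + m) (t + n).
(* At u in F_p, P is the value of the form on the transforms of the two monomials by (1, u; 0, 1),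
   minus its original value. *)
pose P : {poly K} :=
  \sum_(m < a.+1) \sum_(n < b.+1) e m n *: 'X^(m + n) - (c s t)%:P.
have P0 : P = 0.
  apply: (poly_Fp_vanish p_pr (theta := theta)) => [|u].
    rewrite (leq_trans (size_polyD _ _)) // size_polyN geq_max.
    rewrite (leq_trans (size_polyC_leq1 _)) ?prime_gt0 // andbT.
    apply: (leq_trans (size_sum _ _ _)); apply/bigmax_leqP => m _.
    apply: (leq_trans (size_sum _ _ _)); apply/bigmax_leqP => n _.
    apply: (leq_trans (size_scale_leq _ _)); rewrite size_polyXn.
    apply: leq_ltn_trans r12_lt; apply: leq_add.
      by apply: (@leq_trans a); rewrite ?leq_subr -1?ltnS.
    by apply: (@leq_trans b); rewrite ?leq_subr -1?ltnS.
  have := @f_inv (mx2 1 u 0 1); rewrite unitmxE det2 !mxE /= mulr0 subr0 mulr1.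
  move=> /(_ (unitr1 _) (hmon K r1 s) (hmon K r2 t)).
  rewrite rmorph1 expr1n mul1r map_mx2 !rmorph1 rmorph0 !sym_act_unip //.
  rewrite tens_sum => fE; rewrite hornerD hornerN hornerC horner_sum -[c s t]fE.
  apply/eqP; rewrite subr_eq0; apply/eqP; apply: eq_bigr => m _.
  rewrite horner_sum; apply: eq_bigr => n _.
  by rewrite hornerZ hornerXn exprD /e mulrAC mulrACA.
have : P`_1 = 0 by rewrite P0 coef0.
rewrite coefB coefC subr0 coef_sum.
under eq_bigr => m _ do rewrite coef_sum.
under eq_bigr => m _ do under eq_bigr => n _ do rewrite coefZ coefXn.
rewrite (@sum_pair_index1 _ e) /e.
- by rewrite !bin0 !bin1 !addn1 !addn0 mulr1 mul1r.
- by move=> ->; rewrite bin_small // !mul0r.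
- by move=> ->; rewrite bin0 mul1r bin_small // mul0r.
Qed.

(** The swap of x and y has determinant -1, so c(s, t) and c(r1-s, r2-t) agree up to sign. *)
Lemma form_swap s t : (s <= r1)%N -> (t <= r2)%N ->
  c (r1 - s) (r2 - t) = 0 -> c s t = 0.
Proof.
move=> sr1 tr2; have := @f_inv (mx2 0 1 1 0).
rewrite unitmxE det2 !mxE /= mul0r sub0r mulr1 unitrN1.
move=> /(_ isT (hmon K r1 s) (hmon K r2 t)).
by rewrite map_mx2 !rmorph0 !rmorph1 !sym_act_swap // /c => <- ->; rewrite mulr0.
Qed.

Lemma form_torus s t : (s <= r1)%N -> (t <= r2)%N -> c s t != 0 ->
  (p.-1 %| k + (s + t))%N.
Proof.
move=> sr1 tr2 c0; apply: (exp_Fp_dvd p_pr (theta := theta)) => u u0.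
have := @f_inv (mx2 u 0 0 1).
rewrite unitmxE det2 !mxE /= mulr1 mulr0 subr0 unitfE.
move=> /(_ u0 (hmon K r1 s) (hmon K r2 t)).
rewrite map_mx2 !rmorph0 !rmorph1 !sym_act_diag //.
have -> v w x y : tens (x *: v : SymPow K r1) (y *: w : SymPow K r2) =
    (x * y) *: (tens v w : tensor _ _).
  by apply/matrixP => m n; rewrite !mxE !linearZ /= /GRing.scale /= mulrACA.
rewrite linearZ /= /GRing.scale /= mulrA -!exprD => /(canRL (mulfK c0)) ->.
by rewrite divff.
Qed.

End Forms.

(** The raising relation is symmetric in the two factors, so [raising_vanish] applies to c and to
    its transpose. *)
Lemma form_support r1 r2 k (f : 'Hom(tensor (SymPow K r1) (SymPow K r2), K^o)) :
    (r1 + r2 < p)%N -> det_invariant k f -> forall s t,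
    (s <= r1)%N -> (t <= r2)%N -> f (tens (hmon K r1 s) (hmon K r2 t)) != 0 ->
  (s + t <= minn r1 r2)%N.
Proof.
move=> r12p f_inv s t sr1 tr2 c0.
have rel := raising_relation r12p f_inv.
pose c s t : K := f (tens (hmon K r1 s) (hmon K r2 t)).
rewrite leq_min; apply/andP; split; rewrite leqNgt; apply: contra c0 => lt_st.
  apply/eqP; apply: (@raising_vanish (fun t s => c s t) r2 r1 _ _ t s) => //.
  - exact: leq_ltn_trans (leq_addl _ _) r12p.
  - by move=> t' s' tr sr; rewrite addrC; apply: rel.
  - by rewrite addnC.
apply/eqP; apply: (@raising_vanish c r1 r2 _ _ s t) => //.
exact: leq_ltn_trans (leq_addr _ _) r12p.
Qed.

Lemma det_invariant_weights r1 r2 k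
    (f : 'Hom(tensor (SymPow K r1) (SymPow K r2), K^o)) :
  (r1 + r2 < p)%N -> det_invariant k f -> f != 0 ->
  r1 = r2 /\ (p.-1 %| k + r2)%N.
Proof.
move=> r12p f_inv f0.
pose c s t : K := f (tens (hmon K r1 s) (hmon K r2 t)).
have [s [t [sr1 tr2 c0]]] : exists s t, [/\ (s <= r1)%N, (t <= r2)%N & c s t != 0].
  case: (boolP [exists s : 'I_r1.+1, [exists t : 'I_r2.+1, c s t != 0]]).
    case/existsP=> s /existsP[t st0]; exists (val s), (val t).
    by split=> //=; rewrite -ltnS ltn_ord.
  move/existsPn => c0; case/eqP: f0; apply: tensor_ext => P Q.
  rewrite (hmon_span P) (hmon_span Q) tens_sum lfunE /=.
  apply: big1 => s _; apply: big1 => t _; have /existsPn/(_ t) := c0 s.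
  rewrite negbK /c => /eqP ->.
  by rewrite mulr0.
have := form_support r12p f_inv sr1 tr2 c0.
(* The support bound at this reflected entry reads s + t >= max(r1, r2). *)
have c0' : c (r1 - s)%N (r2 - t)%N != 0.
  by apply: contra c0 => /eqP c0; apply/eqP; apply: (form_swap f_inv).
have := form_support r12p f_inv (leq_subr _ _) (leq_subr _ _) c0'.
have := form_torus f_inv sr1 tr2 c0.
rewrite !leq_min => dv /andP[le1 le2] /andP[le3 le4].
have [er est] : r1 = r2 /\ (s + t)%N = r2 by lia.
by split=> //; rewrite -est.
Qed.

(** The weights (-1)^s / C(r, s) are those making the pairing with (u x + v y)^r the evaluation at
    (-v, u). *)
Definition sym_pairing r (P Q : SymPow K r) : K^o :=
  \sum_(s < r.+1) hcoef s P * hcoef (r - s) Q * ((-1) ^+ s / 'C(r, s)%:R).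

Lemma sym_pairing_linearl r (Q : SymPow K r) : linear (@sym_pairing r ^~ Q).
Proof.
move=> a P P'; rewrite /sym_pairing scaler_sumr -big_split; apply: eq_bigr => s _.
rewrite hcoef_linear /= /GRing.scale /=; ring.
Qed.

Lemma sym_pairing_linearr r (P : SymPow K r) : linear (@sym_pairing r P).
Proof.
move=> a Q Q'; rewrite /sym_pairing scaler_sumr -big_split; apply: eq_bigr => s _.
rewrite hcoef_linear /= /GRing.scale /=; ring.
Qed.

Lemma sym_pairing_linpow r (P : SymPow K r) u v : (r < p)%N ->
  sym_pairing P (linpow r u v) = evalh P (- v) u.
Proof.
move=> rp; rewrite evalhE; apply: eq_bigr => s _; have sr := ltn_ord s.
rewrite hcoef_linpow ?leq_subr // subKn // bin_sub // -mulrA; congr (_ * _).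
rewrite [(- v) ^+ s]exprNn; move: (u ^+ _) (v ^+ _) ((-1) ^+ _) => x y z.
by field; rewrite (bin_neq0_lt p_pr theta) // -ltnS sr.
Qed.

(** By [linpow_span], Q may be taken to be (u x + y)^r. With (u', v') the image under A of the
    column (u, v), the row (-v', u') A equals det A times (-v, u), and homogeneity of P yields det A
    ^ r. *)
Lemma sym_pairing_invariant r (A : 'M[K]_2) (P Q : SymPow K r) : (r < p)%N ->
  sym_pairing (sym_act A P) (sym_act A Q) = \det A ^+ r * sym_pairing P Q.
Proof.
move=> rp; pose D (Q : SymPow K r) : K^o :=
  sym_pairing (sym_act A P) (sym_act A Q) - \det A ^+ r * sym_pairing P Q.
apply/eqP; rewrite -subr_eq0 -/(D Q); apply/eqP.
apply: (linpow_span p_pr (theta := theta) rp) => [a Q1 Q2 | u].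
  rewrite /D linearP !sym_pairing_linearr /GRing.scale /= mulrDr mulrBr mulrCA.
  by rewrite opprD addrACA.
rewrite /D sym_act_linpow !sym_pairing_linpow // evalh_act -evalhZ.
apply/eqP; rewrite subr_eq0; apply/eqP; congr evalh; rewrite det2; ring.
Qed.

Lemma sym_pairing_form r k : (r < p)%N -> (p.-1 %| k + r)%N ->
  exists f : 'Hom(tensor (SymPow K r) (SymPow K r), K^o),
    f != 0 /\ det_invariant k f.
Proof.
move=> rp dv; exists (tensor_lift (@sym_pairing r)).
have liftE := tensor_liftE _ _ (@sym_pairing_linearl r) (@sym_pairing_linearr r).
split.
  (* The pairing of y^r with x^r is 1: only the term s = 0 survives. *)
  apply/eqP => /lfunP/(_ (tens (hmon K r 0) (hmon K r r))).
  rewrite liftE lfunE /= /sym_pairing big_ord_recl big1 => [|s _].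
    rewrite subn0 !hcoef_hmon // !eqxx bin0 expr0 !mul1r invr1 addr0.
    by move/eqP; rewrite oner_eq0.
  by rewrite hcoef_hmon //= !mul0r.
move=> A Au P Q; rewrite !liftE sym_pairing_invariant // mulrA det_map_mx.
rewrite -exprD -rmorphXn; case/dvdnP: dv => n ->.
suff -> : \det A ^+ (n * p.-1) = 1 by rewrite rmorph1 mul1r.
rewrite mulnC exprM; rewrite unitmxE unitfE in Au.
suff -> : \det A ^+ p.-1 = 1 by rewrite expr1n.
exact: Fp_exp1.
Qed.

End InvariantForms.

Lemma distinguished_det_invariant (p : nat) (p_pr : prime p) (Fq : finFieldType)
    (K : closedFieldType) (i : {rmorphism 'F_p -> Fq}) (j : {rmorphism Fq -> K})
    (r1 r2 k : nat) :
  distinguished (GL_sub i)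
    (V_repr (pchar_rmorph (j \o i) p_pr) j r1 r2 k) <->
  exists f : 'Hom(tensor (SymPow K r1) (SymPow K r2), K^o),
    f != 0 /\ det_invariant (j \o i) k f.
Proof.
have actE (f : 'Hom(tensor (SymPow K r1) (SymPow K r2), K^o)) g P Q :
    f (V_repr (pchar_rmorph (j \o i) p_pr) j r1 r2 k (GL_map i g) (tens P Q)) =
    (j \o i) (\det (GLval g)) ^+ k *
      f (tens (sym_act (map_mx (j \o i) (GLval g)) P)
              (sym_act (map_mx (j \o i) (GLval g)) Q)).
  rewrite /= scale_lfunE linearZ /= tensor_mapE !lfunE /= /det_char /=.
  rewrite det_map_mx -!map_mx_comp.
  congr (_ * f (tens _ (sym_act _ Q))); apply/matrixP => x y; rewrite !mxE /=.
  rewrite pFrobenius_autE -!rmorphXn; congr (j (i _)).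
  (* Entries in F_p satisfy a^p = a, so the Frobenius twist on the second factor disappears. *)
  by have := expf_card (GLval g x y); rewrite card_Fp.
split=> -[f [f0 fH]]; exists f; split=> //.
  move=> A Au P Q; pose g : {'GL_2['F_p]} := FinRing.unit _ Au.
  have gH : GL_map i g \in GL_sub i by apply: mem_morphim; rewrite inE.
  have /lfunP/(_ (tens P Q)) := fH _ gH.
  by rewrite !comp_lfunE actE id_lfunE.
move=> h /morphimP[g _ _ ->]; apply: tensor_ext => P Q.
rewrite !comp_lfunE actE id_lfunE; exact: fH (valP g) P Q.
Qed.

Theorem proposition3p10 (p : nat) (p_pr : prime p)
    (Fq : finFieldType) (cardFq : #|Fq| = (p ^ 2)%N)
    (K : closedFieldType)
    (i : {rmorphism 'F_p -> Fq}) (j : {rmorphism Fq -> K})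
    (algK : integralRange (j \o i))
    (r1 r2 : nat) (r1_lt : (r1 < p)%N) (r2_lt : (r2 < p)%N)
    (r12_lt : (r1 + r2 < p)%N)
    (k : nat) (k_le : (k <= p ^ 2 - 2)%N) :
  distinguished (GL_sub i)
    (V_repr (pchar_rmorph (j \o i) p_pr) j r1 r2 k) <->
  r1 = r2 /\ (r2%:Z = - k%:Z %[mod p%:Z - 1])%Z.
Proof.
have -> : (r2%:Z = - k%:Z %[mod p%:Z - 1])%Z <-> (p.-1 %| k + r2)%N.
  have -> : (p.-1 %| k + r2)%N = (p.-1%:Z %| k%:Z + r2%:Z)%Z by [].
  have -> : p%:Z - 1 = p.-1%:Z by have := prime_gt0 p_pr; lia.
  rewrite addrC -[X in (_ %| _ + X)%Z]opprK -eqz_mod_dvd.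
  by split=> /eqP.
rewrite distinguished_det_invariant; split=> [[f [f0 f_inv]] | [-> dv]].
  exact: (det_invariant_weights p_pr r12_lt f_inv f0).
exact: (sym_pairing_form p_pr _ r2_lt dv).
Qed.
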